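(* Let $Y$ be a Banach space, $\Theta\subset Y$ a closed convex cone, $g\colon\mathbb{R}^n\to Y$ continuously Fréchet differentiable on $\mathbb{R}^n$, $m\ge 1$, and $\mathcal{F}=\{x\in\mathbb{R}^n : g(x)\in-\Theta\}$. Let $\bar x\in\mathcal{F}$. Then the AKKT-regularity holds at $\bar x$ if and only if, for every continuously differentiable objective function $f=(f_1,\dots,f_m)\colon\mathbb{R}^n\to\mathbb{R}^m$ such that the AKKT condition (for $f$, $g$, $\Theta$) holds at $\bar x$, the KKT condition (for $f$, $g$, $\Theta$) also holds at $\bar x$.
   Context: $\mathbb{R}_+=[0,\infty)$ and $\mathbb{R}^m_+$ is the nonnegative orthant of $\mathbb{R}^m$; $\mathbb{R}^n$ has the Euclidean norm and usual scalar product (identified with its dual). $Y^*$ is the dual of $Y$, $\langle\cdot,\cdot\rangle$ is the canonical pairing, and $\Theta_+:=\{\mu\in Y^* : \langle\mu,\theta\rangle\ge 0\ \ \forall\theta\in\Theta\}$. $\nabla f_i(x)$ is the gradient of $f_i$, $\nabla g(x)\colon\mathbb{R}^n\to Y$ is the derivative of $g$ at $x$, and $\nabla g(x)^*\colon Y^*\to\mathbb{R}^n$ is its adjoint. The underlying problem is to minimize $f$ over $\mathcal{F}$ with respect to $\mathbb{R}^m_+$. For $x\in\mathbb{R}^n$ and $r\in\mathbb{R}_+$ let $K(x,r):=\{\nabla g(x)^*\mu : \mu\in\Theta_+,\ |\langle\mu,g(x)\rangle|\le r\}\subset\mathbb{R}^n$. The AKKT-regularity holds at $\bar x\in\mathcal{F}$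 if $\mathop{\mathrm{Lim\,sup}}_{(x,r)\to(\bar x,0)}K(x,r)\subset K(\bar x,0)$, where the left-hand side is the set of all $\bar w\in\mathbb{R}^n$ for which there exists a sequence $(x^k,r_k,w^k)\in\mathbb{R}^n\times\mathbb{R}_+\times\mathbb{R}^n$ converging to $(\bar x,0,\bar w)$ with $w^k\in K(x^k,r_k)$ for all $k\in\mathbb{N}$. A point $\bar x\in\mathcal{F}$ satisfies the KKT condition if there exists $(\lambda,\mu)\in\mathbb{R}^m_+\times\Theta_+$ such that $\sum_{i=1}^m\lambda_i=1$, $\nabla g(\bar x)^*\mu+\sum_{i=1}^m\lambda_i\nabla f_i(\bar x)=0$, and $\langle\mu,g(\bar x)\rangle=0$. A point $\bar x\in\mathcal{F}$ satisfies the AKKT (approximate Karush--Kuhn--Tucker) condition if there exist $\lambda\in\mathbb{R}^m_+$ with $\sum_{i=1}^m\lambda_i=1$ and sequences $\{x^k\}\subset\mathbb{R}^n$ (not required to be feasible) and $\{\mu^k\}\subset\Theta_+$ such that, as $k\to\infty$: $x^k\to\bar x$; $\nabla g(x^k)^*\mu^k+\sum_{i=1}^m\lambda_i\nabla f_i(\bar x)\to 0$; and $\langle\mu^k,g(x^k)\rangle\to 0$. *)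

(* Defs.v *)
From HB Require Import structures.
From mathcomp Require Import all_boot all_order all_algebra.
From mathcomp Require Import all_classical all_reals all_analysis.
Set Implicit Arguments.
Unset Strict Implicit.
Unset Printing Implicit Defensive.
Import Order.TTheory GRing.Theory Num.Theory.
Import numFieldNormedType.Exports.
Local Open Scope classical_set_scope.
Local Open Scope ring_scope.

(* R^n is 'rV[R]_n.  The library norm on 'rV[R]_n is the sup norm; norms on R^n
   enter below only through limits, Frechet differentiability and continuity of
   the derivative, none of which changes under an equivalent norm.  The
   Euclidean scalar product is used to represent gradients and adjoints. *)

Definition dotv (R : realType) (n : nat) (u v : 'rV[R]_n) : R :=
  \sum_(j < n) u 0 j * v 0 j.

(* The derivative is continuous for the operator norm. *)
Definition continuously_differentiable (R : realType) (V W : normedModType R)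
    (f : V -> W) : Prop :=
  (forall x, differentiable f x) /\
  (forall x (e : R), 0 < e ->
     \forall y \near x, forall h : V, `|'d f y h - 'd f x h| <= e * `|h|).

Definition closed_convex_cone (R : realType) (Y : normedModType R)
    (Theta : set Y) : Prop :=
  [/\ Theta !=set0, closed Theta,
      convex_set (Theta : set (convex_lmodType Y)) &
      (forall u (t : R), Theta u -> 0 <= t -> Theta (t *: u))].

(* Elements of the dual Y^* are the linear functionals on Y satisfying
   [continuous]; R^o is R seen as a normed module over itself. *)
Definition dual_cone (R : realType) (Y : normedModType R) (Theta : set Y) :
    set {linear Y -> R^o} :=
  [set mu : {linear Y -> R^o} |
    continuous mu /\ (forall theta, Theta theta -> 0 <= mu theta)].

Definition feasible (R : realType) (n : nat) (Y : normedModType R)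
    (Theta : set Y) (g : 'rV[R]_n -> Y) : set 'rV[R]_n :=
  [set x | [set - theta | theta in Theta] (g x)].

Definition gradient (R : realType) (n : nat) (h : 'rV[R]_n -> R^o)
    (x : 'rV[R]_n) : 'rV[R]_n :=
  \row_j 'd h x (delta_mx 0 j).

Definition adjoint_derivative (R : realType) (n : nat) (Y : normedModType R)
    (g : 'rV[R]_n -> Y) (x : 'rV[R]_n) (mu : {linear Y -> R^o}) : 'rV[R]_n :=
  \row_j mu ('d g x (delta_mx 0 j)).

Lemma dotv_gradient (R : realType) (n : nat) (h : 'rV[R]_n -> R^o)
    (x v : 'rV[R]_n) :
  dotv (gradient h x) v = 'd h x v.
Proof.
rewrite [in RHS](row_sum_delta v) linear_sum; apply: eq_bigr => j _.
by rewrite mxE linearZ mulrC.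
Qed.

Lemma dotv_adjoint_derivative (R : realType) (n : nat) (Y : normedModType R)
    (g : 'rV[R]_n -> Y) (x : 'rV[R]_n) (mu : {linear Y -> R^o})
    (v : 'rV[R]_n) :
  dotv (adjoint_derivative g x mu) v = mu ('d g x v).
Proof.
rewrite [in RHS](row_sum_delta v) !linear_sum; apply: eq_bigr => j _.
by rewrite mxE !linearZ mulrC.
Qed.

(* The gradient of the i-th component of f at x. *)
Definition component_gradient (R : realType) (n m : nat)
    (f : 'rV[R]_n -> 'rV[R]_m) (i : 'I_m) (x : 'rV[R]_n) : 'rV[R]_n :=
  gradient (fun y => f y 0 i) x.

Definition Kset (R : realType) (n : nat) (Y : normedModType R)
    (Theta : set Y) (g : 'rV[R]_n -> Y) (x : 'rV[R]_n) (r : R) :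
    set 'rV[R]_n :=
  [set adjoint_derivative g x mu |
     mu in [set mu : {linear Y -> R^o} | dual_cone Theta mu /\ `|mu (g x)| <= r]].

(* Painleve-Kuratowski outer limit of K at (xbar, 0), where the second variable
   ranges over [0, +oo[. *)
Definition Limsup (R : realType) (n : nat)
    (K : 'rV[R]_n -> R -> set 'rV[R]_n) (xbar : 'rV[R]_n) : set 'rV[R]_n :=
  [set wbar | exists (x : nat -> 'rV[R]_n) (r : nat -> R)
                     (w : nat -> 'rV[R]_n),
    [/\ (forall k, 0 <= r k),
        (x k, r k, w k) @[k --> \oo] --> (xbar, 0 : R, wbar) &
        (forall k, K (x k) (r k) (w k))]].

Definition AKKT_regular (R : realType) (n : nat) (Y : normedModType R)
    (Theta : set Y) (g : 'rV[R]_n -> Y) (xbar : 'rV[R]_n) : Prop :=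
  Limsup (Kset Theta g) xbar `<=` Kset Theta g xbar 0.

Definition KKT (R : realType) (n m : nat) (Y : normedModType R)
    (f : 'rV[R]_n -> 'rV[R]_m) (g : 'rV[R]_n -> Y) (Theta : set Y)
    (xbar : 'rV[R]_n) : Prop :=
  exists (lambda : 'rV[R]_m) (mu : {linear Y -> R^o}),
    [/\ (forall i, 0 <= lambda 0 i), dual_cone Theta mu,
        \sum_(i < m) lambda 0 i = 1,
        adjoint_derivative g xbar mu
          + \sum_(i < m) lambda 0 i *: component_gradient f i xbar = 0 &
        mu (g xbar) = 0].

(* The multiplier lambda is fixed and the objective gradients are taken at
   xbar; only the constraint terms vary along the sequence. *)
Definition AKKT (R : realType) (n m : nat) (Y : normedModType R)
    (f : 'rV[R]_n -> 'rV[R]_m) (g : 'rV[R]_n -> Y) (Theta : set Y)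
    (xbar : 'rV[R]_n) : Prop :=
  exists (lambda : 'rV[R]_m) (x : nat -> 'rV[R]_n)
         (mu : nat -> {linear Y -> R^o}),
    [/\ (forall i, 0 <= lambda 0 i) /\ \sum_(i < m) lambda 0 i = 1,
        (forall k, dual_cone Theta (mu k)),
        x k @[k --> \oo] --> xbar,
        adjoint_derivative g (x k) (mu k)
          + \sum_(i < m) lambda 0 i *: component_gradient f i xbar
          @[k --> \oo] --> (0 : 'rV[R]_n) &
        mu k (g (x k)) @[k --> \oo] --> (0 : R)].

(* Main.v *)
Require Import Defs.
From HB Require Import structures.
From mathcomp Require Import all_boot all_order all_algebra.
From mathcomp Require Import all_classical all_reals all_analysis.
Import Order.TTheory GRing.Theory Num.Theory.
Import numFieldNormedType.Exports.
Local Open Scope classical_set_scope.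
Local Open Scope ring_scope.

(** AKKT at [xbar] says that [- \sum_i lambda_i (grad f_i)(xbar)] lies in the
    outer limit of [K] at [(xbar, 0)], and KKT that it lies in [K(xbar, 0)], so
    AKKT-regularity gives AKKT => KKT.  Conversely, a point [w] of the outer
    limit is tested with the objective all of whose components are the linear
    form [x |-> - <w, x>]: whatever the weights [lambda] returned by KKT, the
    combined gradient is [- w]. *)

(** Expanding the argument in the standard basis writes [f] as a finite sum of coordinate functions
    times fixed vectors, and each such term is continuous. *)
Lemma continuous_linear_rV (R : realType) (n : nat) (V : normedModType R)
    (f : {linear 'rV[R]_n -> V}) :
  continuous f.
Proof.
have sum_cont (s : seq 'I_n) :
    continuous (fun y : 'rV[R]_n => \sum_(j <- s) y 0 j *: f (delta_mx 0 j)).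
  elim: s => [|j s IH].
    rewrite (_ : (fun _ => _) = cst 0); first exact: cst_continuous.
    by apply/funext => y; rewrite big_nil.
  have -> : (fun y : 'rV[R]_n =>
        \sum_(i <- j :: s) y 0 i *: f (delta_mx 0 i)) =
      (fun y => y 0 j *: f (delta_mx 0 j)) +
      (fun y => \sum_(i <- s) y 0 i *: f (delta_mx 0 i)).
    by apply/funext => y; rewrite big_cons.
  move=> x; apply: (@continuousD _ _ 'rV[R]_n); last exact: IH.
  by apply: (@continuousZr_tmp _ _ 'rV[R]_n); exact: coord_continuous.
rewrite (_ : (f : 'rV[R]_n -> V) =
    fun y => \sum_(j < n) y 0 j *: f (delta_mx 0 j)).
  exact: sum_cont.
apply/funext => y; rewrite {1}(row_sum_delta y) linear_sum.
by apply: eq_bigr => j _; rewrite linearZ.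
Qed.

Lemma diff_linear_rV (R : realType) (n : nat) (V : normedModType R)
    (f : 'rV[R]_n -> V) (x : 'rV[R]_n) :
  linear f -> 'd f x = f :> ('rV[R]_n -> V).
Proof.
move=> lin_f.
pose fM := GRing.isLinear.Build _ _ _ _ _ lin_f.
pose fL : {linear 'rV[R]_n -> V} := HB.pack f fM.
exact: (diff_lin _ (@continuous_linear_rV _ _ _ fL)).
Qed.

(** The derivative is [f] itself at every point, so its variation vanishes. This makes linear test
    objectives admissible in the converse direction. *)
Lemma linear_rV_continuously_differentiable (R : realType) (n : nat)
    (V : normedModType R) (f : 'rV[R]_n -> V) :
  linear f -> continuously_differentiable f.
Proof.
move=> lin_f; split=> [x|x e e0].
  pose fM := GRing.isLinear.Build _ _ _ _ _ lin_f.
  pose fL : {linear 'rV[R]_n -> V} := HB.pack f fM.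
  exact: (linear_differentiable _ (@continuous_linear_rV _ _ _ fL)).
apply: (@nearW _ (nbhs x)) => y h; rewrite !diff_linear_rV // subrr normr0.
by rewrite mulr_ge0 // ltW.
Qed.

Lemma dotv_linear (R : realType) (n : nat) (u : 'rV[R]_n) :
  linear (dotv u : 'rV[R]_n -> R^o).
Proof.
move=> a v w; rewrite /dotv scaler_sumr -big_split; apply: eq_bigr => j _ /=.
by rewrite !mxE mulrDr mulrCA.
Qed.

Lemma gradient_dotv (R : realType) (n : nat) (u x : 'rV[R]_n) :
  gradient (dotv u) x = u.
Proof.
apply/rowP => j; rewrite mxE (diff_linear_rV _ _ _ _ _ (dotv_linear _ _ u)).
rewrite /dotv (bigD1 j) //= mxE !eqxx mulr1 big1 ?addr0 // => i /negPf ij.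
by rewrite mxE ij andbF mulr0.
Qed.

Theorem theorem3p15 (R : realType) (n m : nat) (Y : completeNormedModType R)
    (Theta : set Y) (g : 'rV[R]_n -> Y) (xbar : 'rV[R]_n)
    (hm : (0 < m)%N)
    (hTheta : closed_convex_cone Theta)
    (hg : continuously_differentiable g)
    (hxbar : feasible Theta g xbar) :
  AKKT_regular Theta g xbar <->
  (forall f : 'rV[R]_n -> 'rV[R]_m,
     continuously_differentiable f ->
     AKKT f g Theta xbar -> KKT f g Theta xbar).
Proof.
split=> [reg f _|AKKT_KKT w [x [r [v [r0 xrv_cvg Kv]]]]].
  case=> lambda [x [mu [[lam0 lam1] mu_dual x_cvg grad_cvg comp_cvg]]].
  set G := \sum_(i < m) _ in grad_cvg.
  (* The radius paired with [x k] is the least [r] for which [mu k] witnesses membership in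
     [Kset Theta g (x k) r]. *)
  have r_cvg : `|mu k (g (x k))| @[k --> \oo] --> (0 : R).
    by rewrite -(normr0 R); exact: cvg_norm.
  have w_cvg : adjoint_derivative g (x k) (mu k) @[k --> \oo] --> - G.
    rewrite -(add0r (- G)).
    rewrite (_ : (fun k => _) =
        fun k => adjoint_derivative g (x k) (mu k) + G - G).
      by apply: cvgB => //; exact: cvg_cst.
    by apply/funext => k; rewrite addrK.
  have [|nu [nu_dual nu_comp] nuE] := reg (- G).
    exists x, (fun k => `|mu k (g (x k))|),
      (fun k => adjoint_derivative g (x k) (mu k)); split=> // [|k].
      exact: (cvg_pair (cvg_pair x_cvg r_cvg) w_cvg).
    by exists (mu k).
  exists lambda, nu; split=> //; first by rewrite nuE addNr.
  (* Radius [0] in the limit set turns the bound on the pairing into exact complementarity. *)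
  by apply/eqP; rewrite -normr_le0.
have [x_cvg r_cvg v_cvg] : [/\ x k @[k --> \oo] --> xbar,
    r k @[k --> \oo] --> 0 & v k @[k --> \oo] --> w].
  split.
  - exact: (cvg_comp _ _ (cvg_comp _ _ xrv_cvg cvg_fst) cvg_fst).
  - exact: (cvg_comp _ _ (cvg_comp _ _ xrv_cvg cvg_fst) cvg_snd).
  - exact: (cvg_comp _ _ xrv_cvg cvg_snd).
(* Membership in [Kset] only gives a multiplier for each [k]; AKKT asks for a sequence of them. *)
have /choice[mu muP] : forall k, exists nu : {linear Y -> R^o},
    [/\ dual_cone Theta nu, `|nu (g (x k))| <= r k &
        adjoint_derivative g (x k) nu = v k].
  by move=> k; have [nu [? ?] ?] := Kv k; exists nu.
pose f (y : 'rV[R]_n) : 'rV[R]_m := const_mx (dotv (- w) y).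
have f_lin : linear f.
  move=> a y z; apply/rowP => i; rewrite !mxE.
  exact: (dotv_linear R n (- w) a y z).
have grad_f i : component_gradient f i xbar = - w.
  rewrite /component_gradient (_ : (fun y => f y 0 i) = dotv (- w)).
    exact: gradient_dotv.
  by apply/funext => y; rewrite mxE.
(* Kept general in [lambda]: it serves both the weights chosen to establish AKKT and the possibly
   different ones that KKT returns. *)
have grad_sum (lambda : 'rV[R]_m) : \sum_(i < m) lambda 0 i = 1 ->
    \sum_(i < m) lambda 0 i *: component_gradient f i xbar = - w.
  move=> lam1; under eq_bigr do rewrite grad_f.
  by rewrite -scaler_suml lam1 scale1r.
have [|lambda [nu [_ nu_dual lam1 nuE nu_comp]]] :=
  AKKT_KKT f (linear_rV_continuously_differentiable _ _ _ f f_lin).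
  (* Any weights of sum 1 would do; this vertex of the simplex exists because [0 < m]. *)
  pose lambda : 'rV[R]_m := delta_mx 0 (Ordinal hm).
  have lam1 : \sum_(i < m) lambda 0 i = 1.
    rewrite (bigD1 (Ordinal hm)) //= mxE !eqxx big1 ?addr0 // => i /negPf im.
    by rewrite mxE im andbF.
  exists lambda, x, mu; split=> //.
  - by split=> // i; rewrite mxE.
  - by move=> k; have [] := muP k.
  - rewrite grad_sum // -(subrr w).
    (* The adjoint term is [v k], so the sequence becomes [v k - w]. *)
    under eq_fun do rewrite (let: And3 _ _ e := muP _ in e).
    by apply: cvgB => //; exact: cvg_cst.
  (* The absolute value of the pairing is squeezed between [0] and [r k]. *)
  - apply: norm_cvg0; apply: (squeeze_cvgr _ (cvg_cst 0) r_cvg).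
    by apply: nearW => k; have [_ ->] := muP k; rewrite normr_ge0.
exists nu; first by split=> //; rewrite nu_comp normr0.
by move: nuE; rewrite grad_sum // => /subr0_eq.
Qed.
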